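(* Let $p\ge 1$, $s>1$, $\varepsilon>0$, let $\tau\in\mathcal{T}([0,1];s,\varepsilon)$, and let $q$ be a noise profile. Assume that $\tau$ satisfies the Lasota--Yorke condition with constants $\alpha_0, C_0$, and that the joint expansion--kernel condition $\alpha_0<1/\widetilde{C}_1$ holds. For $\delta\in(0,1/4)$ let $P_\delta=Q_\delta P_\tau$. Then there exist constants $0<\alpha<1$ and $C>0$, independent of $\delta$, such that for all $\delta\in(0,1/4)$ and all $f\in BV_{1,1/p}(I)$, $$\|P_\delta f\|_{1,1/p}\le \alpha\,\|f\|_{1,1/p}+C\,\|f\|_1 .$$
   Context: Let $I=[0,1]$, let $m$ be Lebesgue measure on $I$, and let $\|\cdot\|_1$ be the norm of $L^1(I)$. Oscillation and the space $BV_{1,1/p}(I)$: for measurable $f:I\to\mathbb{R}$ and $r>0$ put $\operatorname{Osc}(f,r,x)=\sup\{|f(y_1)-f(y_2)|: y_1,y_2\in(x-r,x+r)\cap I\}$ and $\operatorname{Osc}_1(f,r)=\int_I\operatorname{Osc}(f,r,x)\,dm(x)$. For $p\ge1$, $\operatorname{var}_{1,1/p}(f)=\sup_{0<r\le1} r^{-1/p}\operatorname{Osc}_1(f,r)$; $BV_{1,1/p}(I)$ is the set of $f\in L^1(I)$ with $\operatorname{var}_{1,1/p}(f)<\infty$, normed by $\|f\|_{1,1/p}=\operatorname{var}_{1,1/p}(f)+\|f\|_1$. It is a Banach space, continuously embedded in $L^1(I)$, and its unit ball is relatively compact in $L^1(I)$. The class $\mathcal{T}([0,1];s,\varepsilon)$: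 a map $\tau:I\to I$ belongs to it if there is a finite partition $0=a_0<a_1<\dots<a_q=1$ (here $q$ is an integer, unrelated to the noise profile below) such that (1) for each $i$, $\tau$ is monotone and $C^{1+\varepsilon}$ on $(a_{i-1},a_i)$, extending continuously to $[a_{i-1},a_i]$; (2) $|\tau'(x)|\ge s>1$ wherever $\tau'$ is defined; (3) $\tau'$ is $\varepsilon$-Hölder continuous on each interval. $P_\tau:L^1(I)\to L^1(I)$ is the Frobenius--Perron operator of $\tau$: $\int_A P_\tau f\,dm=\int_{\tau^{-1}(A)}f\,dm$ for all measurable $A\subset I$. Lasota--Yorke condition for $P_\tau$ (standing assumption): there are constants $0<\alpha_0<1$ and $C_0>0$, depending only on $\tau$, with $\operatorname{var}_{1,1/p}(P_\tau f)\le\alpha_0\|f\|_{1,1/p}+C_0\|f\|_1$ for all $f\in BV_{1,1/p}(I)$; moreover $\alpha_0\le s^{-1/p}$. Noise profile: a $C^1$ function $q:\mathbb{R}\to[0,\infty)$ with $\operatorname{supp}(q)\subset[-1,1]$, $\int_{\mathbb{R}}q(z)\,dz=1$ and $q'\in L^\infty(\mathbb{R})$. For $\delta\in(0,1/4)$ the periodized kernel is $q_\delta^{\mathrm{per}}(x,y)=\sum_{n\in\mathbb{Z}}\delta^{-1}q\left(\frac{x-y+n}{\delta}\right)$, $x,y\in I$, and $(Q_\delta f)(x)=\int_I q_\delta^{\mathrm{per}}(x,y)f(y)\,dy$. Joint expansion--kernel condition (standing assumption): $\alpha_0<1/\widetilde{C}_1$, where $\widetilde{C}_1=(1+2^{1+1/p})\cdot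 2^{1/p}\max\{1,4\|q'\|_\infty\}$. *)

(* Defs.v *)
(* Real and measure-theoretic notions from MathComp-Analysis. *)
From HB Require Import structures.
From mathcomp Require Import all_boot all_order all_algebra.
From mathcomp Require Import all_classical all_reals all_analysis.
Set Implicit Arguments.
Unset Strict Implicit.
Unset Printing Implicit Defensive.
Import Order.TTheory GRing.Theory Num.Theory.
Import numFieldNormedType.Exports.
Local Open Scope classical_set_scope.
Local Open Scope ring_scope.

(* Elements of L^1(I), I = [0,1], are represented by functions R -> R that are
   integrable on I; values outside I are irrelevant.  Every quantity applied
   below to an element of L^1(I) depends only on its a.e.-class on I, with the
   exception of osc, osc1 and fvar, which are used only to define var. *)

Section Definitions.
Context {R : realType}.
Implicit Types (f g tau q : R -> R) (P : (R -> R) -> R -> R).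
Implicit Types (p s eps r delta : R).

Local Notation mu := (@lebesgue_measure R).

Definition unitI : set R := `[0, 1].

Definition osc f r x : \bar R :=
  ereal_sup [set `|f y.1 - f y.2|%:E | y in
    (`]x - r, x + r[ `&` unitI) `*` (`]x - r, x + r[ `&` unitI)].

Definition osc1 f r : \bar R := (\int[mu]_(x in unitI) osc f r x)%E.

Definition fvar p f : \bar R :=
  ereal_sup [set ((r `^ (- p^-1))%:E * osc1 f r)%E | r in `]0, 1]].

(* fvar depends on the values of f at every point.  On L^1(I), whose elements
   are only determined a.e., var_{1,1/p} is its infimum over all versions. *)
Definition var p f : \bar R :=
  ereal_inf [set fvar p g | g in
    [set g | measurable_fun unitI g /\
             {ae mu, forall x, unitI x -> g x = f x}]].

Definition norm1 f : \bar R := (\int[mu]_(x in unitI) `|f x|%:E)%E.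

Definition normBV p f : \bar R := (var p f + norm1 f)%E.

Definition BV p : set (R -> R) :=
  [set f | mu.-integrable unitI (EFin \o f) /\ (var p f < +oo)%E].

(* l and r are consecutive partition points.  The derivative is only evaluated
   inside I, where derive1 tau does not involve the values of tau outside I. *)
Definition expanding_branch eps tau (l r : R) : Prop :=
  [/\ {in `]l, r[ &, {homo tau : x y / x <= y}} \/
        {in `]l, r[ &, {homo tau : x y /~ x <= y}},
      (forall x, x \in `]l, r[ -> derivable tau x 1) /\
        {within `]l, r[, continuous (derive1 tau)},
      exists taubar : R -> R, {within `[l, r], continuous taubar} /\
        {in `]l, r[, taubar =1 tau}
    & exists H : R, {in `]l, r[ &, forall x y,
        `|derive1 tau x - derive1 tau y| <= H * `|x - y| `^ eps}].

Definition piecewise_expanding s eps tau : Prop :=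
  (forall x, unitI x -> unitI (tau x)) /\
  exists a : seq R, [/\ itv_partition 0 1 a,
    forall i, (i < size a)%N ->
      expanding_branch eps tau (nth 0 (0 :: a) i) (nth 0 (0 :: a) i.+1)
    & forall x, x \in `]0, 1[ -> derivable tau x 1 -> s <= `|derive1 tau x|].

(* P is a choice of versions of the Frobenius--Perron operator of tau; the
   defining identity determines P f up to equality a.e. on I. *)
Definition frobenius_perron tau P : Prop :=
  forall f, mu.-integrable unitI (EFin \o f) ->
    mu.-integrable unitI (EFin \o P f) /\
    forall A, measurable A -> A `<=` unitI ->
      (\int[mu]_(x in A) (P f x)%:E =
       \int[mu]_(x in unitI `&` tau @^-1` A) (f x)%:E)%E.

Definition lasota_yorke p s P (alpha0 C0 : R) : Prop :=
  [/\ 0 < alpha0 < 1, 0 < C0, alpha0 <= s `^ (- p^-1)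
    & forall f, BV p f ->
      (var p (P f) <= alpha0%:E * normBV p f + C0%:E * norm1 f)%E].

Definition noise_profile q : Prop :=
  [/\ (forall x, derivable q x 1) /\ continuous (derive1 q),
      forall z, 0 <= q z,
      closure [set z | q z != 0] `<=` `[-1, 1],
      (\int[mu]_z (q z)%:E = 1)%E
    & derive1 q \in Lfun mu +oo%E].

(* A sum over all integers of nonnegative terms, finitely many of which are
   nonzero when q is a noise profile. *)
Definition qper q delta x y : R :=
  fine (\esum_(n in [set: int]) (delta^-1 * q ((x - y + n%:~R) / delta))%:E)%E.

Definition noise_op q delta f : R -> R :=
  fun x => \int[mu]_(y in unitI) (qper q delta x y * f y).

Definition C1tilde p q : R :=
  (1 + 2 `^ (1 + p^-1)) * 2 `^ p^-1 *
  Num.max 1 (4 * fine ('N[mu]_+oo[EFin \o derive1 q])%E).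

End Definitions.

(* Main.v *)
Require Import Defs.
From HB Require Import structures.
From mathcomp Require Import all_boot all_order all_algebra.
From mathcomp Require Import all_classical all_reals all_analysis.
From mathcomp Require Import measurable_realfun lra.
Import Order.TTheory GRing.Theory Num.Theory.
Import numFieldNormedType.Exports.
Local Open Scope classical_set_scope.
Local Open Scope ring_scope.

(** Extend a function h on I = [0,1] to the 1-periodic function on the line
    that agrees with h on [0,1).  Averaging against the periodized kernel is
    then an honest convolution on the line: for x in I,
      (Q h)(x) = int q(z) h(x - delta z) dz                 (noise_op_smoothing).
    Hence the oscillation of Q h on a ball about x is at most the q-average over
    z of the oscillation of the periodic extension on the ball about
    x - delta z.  Tonelli and the translation invariance of the integral over a
    period remove the average, because q has mass 1
    (ge0_integral_periodic_smoothing): the integrated oscillation of Q h on I is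
    at most that of the periodic extension, uniformly in delta.

    The extension has oscillation beyond that of h only on balls that cross an
    integer, so for x in a set of measure at most 2r, and there the excess is at
    most the total oscillation V of h on I (integral_osc_periodize).  The
    ball of radius 1 about any interior point of I contains I, so V is itself
    at most Osc_1(h, 1), hence at most var(h).  As r^(-1/p) r <= 1 for r <= 1 and p >= 1, this gives
      var(Q h) <= var(h) + 2 var(h) = 3 var(h)              (fvar_noise_op_le),
    and the same convolution argument applied to |h| gives
    ||Q h||_1 <= ||h||_1 (norm1_noise_op_le).

    Testing the defining identity of the Frobenius--Perron operator on the sets
    where P f is nonnegative and negative gives ||P f||_1 <= 2 ||f||_1, so with
    the Lasota--Yorke inequality
      ||Q P f|| <= 3 (alpha0 ||f|| + C0 ||f||_1) + 2 ||f||_1.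
    The joint condition makes 3 alpha0 < 1, since the constant in it is at
    least 3 (C1tilde_ge3). *)

(** * Affine changes of variable for Lebesgue measure *)

Section AffineChangeOfVariable.
Context {R : realType}.
Local Notation mu := (@lebesgue_measure R).

(** The domain and codomain are the Borel line that carries Lebesgue measure, so
    that preimages under the map can be measured directly. *)
Definition affine (a c : R) : measurableTypeR R -> measurableTypeR R :=
  fun z => a * z + c.

Lemma measurable_affine a c : measurable_fun setT (affine a c).
Proof.
by apply: measurable_funD => //; exact: measurable_funM.
Qed.

(** Both sides are measures in A, and they agree on half-open intervals, which
    determine Lebesgue measure. *)
Lemma lebesgue_measure_affine a c (A : set R) : a != 0 -> measurable A ->
  mu A = (`|a|%:E * mu (affine a c @^-1` A))%E.
Proof.
move=> a0 mA.
pose aff : {mfun measurableTypeR R >-> measurableTypeR R} :=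
  HB.pack (affine a c) (isMeasurableFun.Build _ _ _ _ _ (measurable_affine a c)).
rewrite (@lebesgue_measure_unique R (mscale `|a|%:nng (pushforward mu aff)))//.
move=> X [[x y]] _ <-; rewrite -[RHS]/(`|a|%:E * mu (affine a c @^-1` `]x, y]%classic))%E.
have [a_gt0|a_le0] := ltP 0 a.
- rewrite (_ : affine a c @^-1` _ = `](x - c) / a, (y - c) / a]%classic); last first.
    by rewrite predeqE => z/=; rewrite !in_itv/= /affine ltr_pdivrMr// ler_pdivlMr//
      (mulrC z) ltrBlDr lerBrDr.
  rewrite !lebesgue_measure_itv/= !lte_fin ltr_pM2r ?invr_gt0// ltrD2r.
  case: ifPn => _; last by rewrite mule0.
  rewrite gtr0_norm// -!EFinD -EFinM -mulrBl mulrC divfK//.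
  by congr EFin; lra.
- have {a0 a_le0}a_lt0 : a < 0 by rewrite lt_neqAle a0.
  rewrite (_ : affine a c @^-1` _ = `[(y - c) / a, (x - c) / a[%classic); last first.
    by rewrite predeqE => z/=; rewrite !in_itv/= /affine ltr_ndivlMr// ler_ndivrMr//
      (mulrC z) ltrBlDr lerBrDr andbC.
  rewrite !lebesgue_measure_itv/= !lte_fin ltr_nM2r ?invr_lt0// ltrD2r.
  case: ifPn => _; last by rewrite mule0.
  rewrite ltr0_norm// -!EFinD -EFinM -mulrBl mulrC mulrN divfK ?lt_eqF//.
  by congr EFin; lra.
Qed.

Lemma ge0_integral_affine a c (D : set R) (f : R -> \bar R) :
  a != 0 -> measurable D -> measurable_fun setT f -> (forall x, 0 <= f x)%E ->
  (\int[mu]_(x in D) f x =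
   `|a|%:E * \int[mu]_(x in affine a c @^-1` D) f (affine a c x))%E.
Proof.
move=> a0 mD mf f0.
rewrite -[X in (_ * X)%E](ge0_integral_pushforward (measurable_affine a c) mu)//; last 1 first.
  exact: measurable_funTS.
rewrite -(@ge0_integral_mscale _ (measurableTypeR R) R _ D mD (`|a|%:nng))//;
  last exact: measurable_funTS.
  exact: measurable_affine.
by move=> maff; apply: eq_measure_integral => A mA AD; exact: lebesgue_measure_affine.
Qed.

Lemma integral_affine a c (D : set R) (f : R -> \bar R) : a != 0 ->
  measurable D -> measurable_fun setT f -> mu.-integrable D f ->
  (\int[mu]_(x in D) f x =
   `|a|%:E * \int[mu]_(x in affine a c @^-1` D) f (affine a c x))%E.
Proof.
move=> a0 mD mf intf.
have [mp mn] := (measurable_funepos mf, measurable_funeneg mf).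
have Ep := @ge0_integral_affine a c D _ a0 mD mp (funepos_ge0 f).
have En := @ge0_integral_affine a c D _ a0 mD mn (funeneg_ge0 f).
rewrite integralE Ep En.
rewrite -muleBr.
- rewrite [in RHS]integralE; congr (_ * (_ - _))%E; apply: eq_integral => x _.
  + by rewrite -[LHS]/((f^\+ \o affine a c)%E x) -funepos_comp.
  + by rewrite -[LHS]/((f^\- \o affine a c)%E x) -funeneg_comp.
- by [].
apply: ltpinfty_adde_def; rewrite inE/=; last first.
  rewrite lteNl; apply: (@lt_le_trans _ _ 0%E) => //.
  by apply: integral_ge0 => x _; exact: funeneg_ge0.
have /(_ mD) := integral_funepos_lt_pinfty _ intf.
rewrite Ep; set X := integral _ _ _.
case: X => [r _| |//]; first exact: ltry.
by rewrite gt0_muley// lte_fin normr_gt0.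
Qed.

Lemma Rintegral_affine a c (D : set R) (f : R -> R) : a != 0 ->
  measurable D -> measurable_fun setT f -> mu.-integrable D (EFin \o f) ->
  \int[mu]_(x in D) f x =
  `|a| * \int[mu]_(x in affine a c @^-1` D) f (affine a c x).
Proof.
move=> a0 mD mf intf; rewrite /Rintegral (@integral_affine a c)//; last first.
  exact/measurable_EFinP.
move: (integral _ _ _) => [x|/=|/=]; first by rewrite fineM.
  by rewrite gt0_muley ?lte_fin ?normr_gt0// mulr0.
by rewrite gt0_muleNy ?lte_fin ?normr_gt0// mulr0.
Qed.

End AffineChangeOfVariable.

(** * Oscillation and the periodic extension *)

Section Oscillation.
Context {R : realType}.
Local Notation mu := (@lebesgue_measure R).
Implicit Types (S : set R) (f h : R -> R) (r x : R).

Lemma measurable_unitI : measurable (@unitI R : set (measurableTypeR R)).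
Proof. exact: measurable_itv. Qed.

(** For S = [0,1] this is the oscillation osc; S = setT serves for functions on
    the whole line. *)
Definition osc_on S f r x : \bar R :=
  ereal_sup [set `|f y.1 - f y.2|%:E | y in
    (`]x - r, x + r[ `&` S) `*` (`]x - r, x + r[ `&` S)].

Lemma osc_on_ub S f r x y1 y2 : S y1 -> S y2 ->
  x - r < y1 < x + r -> x - r < y2 < x + r ->
  (`|f y1 - f y2|%:E <= osc_on S f r x)%E.
Proof.
move=> Sy1 Sy2 xy1 xy2; apply: ereal_sup_ubound; by exists (y1, y2) => //=.
Qed.

Lemma osc_on_le S f r x (c : \bar R) :
  (forall y1 y2, S y1 -> S y2 ->
    x - r < y1 < x + r -> x - r < y2 < x + r -> (`|f y1 - f y2|%:E <= c)%E) ->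
  (osc_on S f r x <= c)%E.
Proof.
move=> H; apply: ge_ereal_sup => _ [[y1 y2] /= yy <-]; move: yy; rewrite !in_itv/=.
move=> [[xy1 Sy1] [xy2 Sy2]]; exact: H.
Qed.

Lemma osc_on_ge0 S f r x : 0 < r -> S x -> (0 <= osc_on S f r x)%E.
Proof.
move=> r0 Sx; have xr : x - r < x < x + r by lra.
by apply: (@le_trans _ _ `|f x - f x|%:E); [rewrite lee_fin|exact: osc_on_ub].
Qed.

(** The balls are open, so two points that witness oscillation greater than a on
    the ball about x also do so for every centre near x: the function is lower
    semicontinuous. *)
Lemma measurable_osc_on S f r : measurable_fun setT (osc_on S f r).
Proof.
apply: lower_semicontinuous_measurable => x a /ereal_sup_gt[_ [[y1 y2]/= yy <-] ay].
move: yy; rewrite !in_itv/= => -[[xy1 Sy1] [xy2 Sy2]].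
exists (`]Num.max y1 y2 - r, Num.min y1 y2 + r[%classic).
  apply: open_nbhs_nbhs; split; first exact: interval_open.
  rewrite /= in_itv/= ltrBlDr gt_max -[X in _ && X]ltrBlDr lt_min.
  lra.
move=> z /=; rewrite in_itv/= ltrBlDr gt_max -[X in _ && X]ltrBlDr lt_min => yz.
by apply: (lt_le_trans ay); apply: osc_on_ub => //; lra.
Qed.

(** The values on [0,1) are repeated; the value of h at 1 is discarded, which
    affects no integral. *)
Definition periodize h (t : R) := h (t - (Num.floor t)%:~R).

Lemma frac_itv (t : R) : 0 <= t - (Num.floor t)%:~R < 1.
Proof. have := floor_itv t; rewrite intrD; lra. Qed.

Lemma periodize_id h t : 0 <= t < 1 -> periodize h t = h t.
Proof.
move=> t01; rewrite /periodize.
suff -> : Num.floor t = 0 by rewrite subr0.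
by apply: floor_def; rewrite add0r; move: t01.
Qed.

Lemma periodizeD h t n : periodize h (t + n%:~R) = periodize h t.
Proof.
rewrite /periodize; congr h.
suff -> : Num.floor (t + n%:~R) = Num.floor t + n by rewrite intrD; lra.
by apply: floor_def; have := floor_itv t; rewrite !intrD; lra.
Qed.


Lemma measurable_periodize h :
  measurable_fun unitI h -> measurable_fun setT (periodize h).
Proof.
move=> mh _ A mA; rewrite setTI.
(* the preimage of A consists of the integer translates of its part in [0,1) *)
rewrite (_ : _ @^-1` _ = \bigcup_(n in [set: int])
    ((fun t : R => t - n%:~R) @^-1` (`[0, 1[ `&` (unitI `&` h @^-1` A)))).
  apply: countable_bigcupT_measurable => // n.
  rewrite -[X in measurable X]setTI.
  have mB : measurable (`[0, 1[ `&` (unitI `&` h @^-1` A) : set R).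
    by apply: measurableI => //; apply: mh => //; exact: measurable_itv.
  have mn : measurable_fun setT (fun t : R => t - n%:~R).
    by apply: measurable_funB.
  exact: mn.
apply/seteqP; split => [t At|t [n _]/=].
  exists (Num.floor t) => //=; rewrite /unitI/= !in_itv/=; split.
    exact: frac_itv.
  by split => //; have := frac_itv t; lra.
rewrite in_itv/= => -[n01 [_ hA]].
by rewrite -[t](subrK n%:~R) periodizeD periodize_id.
Qed.

Lemma osc_on_periodizeD h r x n :
  osc_on setT (periodize h) r (x + n%:~R) = osc_on setT (periodize h) r x.
Proof.
have le y m : (osc_on setT (periodize h) r y <=
    osc_on setT (periodize h) r (y + m%:~R))%E.
  apply: osc_on_le => y1 y2 _ _ hy1 hy2.
  rewrite -(periodizeD h y1 m) -(periodizeD h y2 m).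
  by apply: osc_on_ub => //; lra.
apply/eqP; rewrite eq_le le andbT.
apply: le_trans (le _ (- n)) _.
by rewrite intrN addrK.
Qed.

(** Every ball of radius 1 about a point of ]0,1[ contains [0,1], so at radius 1
    the integrand is at least |h y1 - h y2| throughout ]0,1[. *)
Lemma osc_total_le h y1 y2 : unitI y1 -> unitI y2 ->
  (`|h y1 - h y2|%:E <= osc1 h 1)%E.
Proof.
move=> Iy1 Iy2.
have sub : `]0, 1[%classic `<=` (@unitI R).
  by move=> x /=; rewrite /unitI/= !in_itv/=; lra.
have mosc (D : set R) : measurable_fun D (osc h 1).
  by apply: measurable_funTS; exact: measurable_osc_on.
have oscI x : unitI x -> (0 <= osc h 1 x)%E.
  by move=> Ix; exact: osc_on_ge0.
apply: (@le_trans _ _ (\int[mu]_(x in `]0%R, 1%R[) osc h 1 x)%E); last first.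
  apply: ge0_subset_integral => //; [exact: measurable_unitI|exact: mosc].
apply: (@le_trans _ _ (\int[mu]_(x in `]0%R, 1%R[) cst `|h y1 - h y2|%:E x)%E).
  rewrite integral_cst//= lebesgue_measure_itv/= lte_fin ltr01 oppr0 adde0.
  by rewrite mule1.
apply: ge0_le_integral => //.
- by move=> x _; rewrite lee_fin.
- exact: mosc.
- move=> x; rewrite /= in_itv/= => x01.
  move: (Iy1) (Iy2); rewrite /unitI/= !in_itv/= => y1I y2I.
  by apply: osc_on_ub => //; lra.
Qed.

(** A ball about x inside [0,1] sees only h.  A ball that crosses 0 or 1 compares
    two values of h taken at opposite ends of I; the difference is at most V, and
    such x lie within r of an end point, in a set of measure at most 2r. *)
Lemma integral_osc_periodize h r (V : R) : 0 < r ->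
  (forall y1 y2, unitI y1 -> unitI y2 -> `|h y1 - h y2| <= V) ->
  (\int[mu]_(x in unitI) osc_on setT (periodize h) r x <=
   osc1 h r + (2 * r * V)%:E)%E.
Proof.
move=> r0 hV.
have V0 : 0 <= V.
  have I0 : unitI (0 : R) by rewrite /unitI/= in_itv/=; lra.
  by apply: le_trans (hV _ _ I0 I0).
(* the excess of the periodic oscillation over the one of h *)
pose jump (x : R) := V * \1_(`[0, r[%classic : set R) x +
  V * \1_(`]1 - r, 1]%classic : set R) x.
have mI (D : set R) : measurable D ->
    measurable_fun unitI (fun x => (V * \1_D x)%:E).
  move=> mD; apply/measurable_EFinP; apply: measurable_funM => //.
have mosc S f : measurable_fun unitI (osc_on S f r).
  by apply: measurable_funTS; exact: measurable_osc_on.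
have intI (D : set R) : measurable D -> (mu D <= r%:E)%E ->
    (\int[mu]_(x in unitI) (V * \1_D x)%:E <= (r * V)%:E)%E.
  move=> mD Dr; under eq_integral do rewrite EFinM.
  rewrite ge0_integralZl//; last 2 first.
  - exact: measurable_unitI.
  - exact/measurable_EFinP.
  rewrite integral_indic//; last exact: measurable_unitI.
  rewrite mulrC EFinM lee_wpmul2l//.
  by apply: le_trans Dr; apply: le_measure; rewrite ?inE//;
    apply: measurableI => //; exact: measurable_unitI.
apply: (@le_trans _ _ (\int[mu]_(x in unitI) (osc h r x + (jump x)%:E))%E).
  apply: ge0_le_integral => //; first exact: measurable_unitI.
  - by move=> x Ix; exact: osc_on_ge0.
  - exact: mosc.
  - apply: emeasurable_funD => //; first exact: mosc.
    by rewrite /jump; apply/measurable_EFinP; apply: measurable_funD;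
      apply: measurable_funM => //.
  - move=> x Ix; move: (Ix); rewrite /unitI/= in_itv/= => x01.
    apply: osc_on_le => y1 y2 _ _ hy1 hy2.
    have [xr|xr] := boolP (r <= x <= 1 - r).
      rewrite !periodize_id; [|lra|lra].
      apply: (@le_trans _ _ (osc h r x)).
        by apply: osc_on_ub => //; rewrite /unitI/= in_itv/=; lra.
      by rewrite leeDl// lee_fin addr_ge0 ?mulr_ge0.
    apply: (@le_trans _ _ (jump x)%:E); last first.
      by rewrite leeDr//; exact: osc_on_ge0.
    rewrite lee_fin; apply: (@le_trans _ _ V).
      by apply: hV; rewrite /unitI/= in_itv/=; have := frac_itv y1; have := frac_itv y2; lra.
    move: xr; rewrite negb_and -!ltNge /jump !indicE => /orP[xr|xr].
      rewrite mem_set/= ?in_itv/=; last lra.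
      by rewrite mulr1 lerDl mulr_ge0.
    rewrite addrC mem_set/= ?in_itv/=; last lra.
    by rewrite mulr1 lerDl mulr_ge0.
have mJ : measurable_fun unitI (fun x => (jump x)%:E).
  by rewrite /jump; apply/measurable_EFinP; apply: measurable_funD;
      apply: measurable_funM.
rewrite (ge0_integralD _ measurable_unitI)//; last 3 first.
- by move=> x Ix; exact: osc_on_ge0.
- exact: mosc.
- by move=> x _; rewrite lee_fin addr_ge0 ?mulr_ge0.
apply: leeD => //; rewrite /jump.
under eq_integral do rewrite EFinD.
rewrite (ge0_integralD _ measurable_unitI)//; last 4 first.
- by move=> x _; rewrite lee_fin mulr_ge0.
- exact: mI.
- by move=> x _; rewrite lee_fin mulr_ge0.
- exact: mI.
rewrite (_ : 2 * r * V = r * V + r * V); last lra.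
rewrite EFinD; apply: leeD; apply: intI => //.
- by rewrite lebesgue_measure_itv/= lte_fin r0 oppr0 adde0.
- rewrite lebesgue_measure_itv/= lte_fin ltrBlDr ltrDl r0 -EFinD lee_fin; lra.
Qed.

End Oscillation.

(** * Averages of periodic functions *)

Section Periodic.
Context {R : realType}.
Local Notation mu := (@lebesgue_measure R).

Lemma preimage_shift_itv (c x y : R) :
  affine 1 c @^-1` `[x, y[%classic = `[x - c, y - c[%classic.
Proof. by rewrite predeqE => z/=; rewrite !in_itv/= /affine mul1r; split; lra. Qed.

Lemma ge0_integral_shift_itv (c x y : R) (f : R -> \bar R) :
  measurable_fun setT f -> (forall x, 0 <= f x)%E ->
  (\int[mu]_(t in [set` `[x - c, y - c[%R]) f (t + c)%R = \int[mu]_(t in [set` `[x, y[%R]) f t)%E.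
Proof.
move=> mf f0; rewrite [RHS](@ge0_integral_affine R 1 c)//.
rewrite normr1 mul1e preimage_shift_itv; apply: eq_integral => t _.
by rewrite /affine mul1r.
Qed.

Lemma ge0_integral_itv_cat (x y z : R) (f : R -> \bar R) : x <= y -> y <= z ->
  measurable_fun setT f -> (forall x, 0 <= f x)%E ->
  (\int[mu]_(t in [set` `[x, z[%R]) f t =
   \int[mu]_(t in [set` `[x, y[%R]) f t + \int[mu]_(t in [set` `[y, z[%R]) f t)%E.
Proof.
move=> xy yz mf f0.
rewrite -ge0_integral_setU//=; last 2 first.
  exact: measurable_funTS.
  by apply/disj_setPS => t /=; rewrite !in_itv/=; lra.
congr integral; rewrite predeqE => t /=; rewrite !in_itv/=; lra.
Qed.

(** By periodicity only the fractional part d of c matters; the period [-d, 1-d)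
    is cut at 0, and its left piece is moved by 1 to complete [0, 1-d). *)
Lemma ge0_integral_periodic_shift (G : R -> \bar R) (c : R) :
  measurable_fun setT G -> (forall x, 0 <= G x)%E ->
  (forall (x : R) (n : int), G (x + n%:~R) = G x) ->
  (\int[mu]_(x in unitI) G (x - c)%R = \int[mu]_(x in unitI) G x)%E.
Proof.
move=> mG G0 GD.
have half (f : R -> \bar R) : measurable_fun setT f ->
    (\int[mu]_(x in unitI) f x = \int[mu]_(x in `[0%R, 1%R[) f x)%E.
  by move=> mf; rewrite integral_itv_bndo_bndc//; exact: measurable_funTS.
have mshift (d : R) : measurable_fun setT (fun x : R => G (x + d)).
  by apply: measurableT_comp => //; apply: measurable_funD.
pose d := c - (Num.floor c)%:~R.
have d01 : 0 <= d < 1 by exact: frac_itv.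
have -> : (fun x : R => G (x - c)) = (fun x : R => G (x - d)).
  apply/funext => x; rewrite -(GD (x - c) (Num.floor c)); congr G.
  by rewrite /d; lra.
rewrite !half//.
have := @ge0_integral_shift_itv (- d) (- d) (1 - d) G mG G0.
rewrite !opprK addNr subrK => ->.
rewrite (@ge0_integral_itv_cat _ 0)//; [|lra|lra].
rewrite [RHS](@ge0_integral_itv_cat _ (1 - d))//; [|lra|lra].
rewrite addeC; congr (_ + _)%E.
have := @ge0_integral_shift_itv (- 1) (- d) 0 G mG G0.
rewrite !opprK add0r addrC => <-.
by apply: eq_integral => x _; rewrite -[in RHS](GD x (-1)).
Qed.

Lemma measurable_smoothing_kernel (q : R -> R) (G : R -> \bar R) (delta : R) :
  measurable_fun setT q -> measurable_fun setT G ->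
  measurable_fun setT (fun u : measurableTypeR R * measurableTypeR R =>
    ((q u.2)%:E * G (u.1 - delta * u.2)%R)%E).
Proof.
move=> mq mG; apply: emeasurable_funM.
  by apply/measurable_EFinP; apply: measurableT_comp.
apply: (measurableT_comp mG); apply: measurable_funB => //.
exact: measurable_funM.
Qed.

Lemma measurable_smoothing (q : R -> R) (G : R -> \bar R) (delta : R) :
  measurable_fun setT q -> (forall z, 0 <= q z) ->
  measurable_fun setT G -> (forall x, 0 <= G x)%E ->
  measurable_fun setT
    (fun x : R => \int[mu]_z ((q z)%:E * G (x - delta * z)%R))%E.
Proof.
move=> mq q0 mG G0; have mF := measurable_smoothing_kernel _ _ delta mq mG.
have F0 u : (0 <= (q u.2)%:E * G (u.1 - delta * u.2)%R)%E.
  by rewrite mule_ge0// lee_fin.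
exact: (measurable_fun_fubini_tonelli_F (m2 := mu) _ mF F0).
Qed.

(** Convolution with a probability density preserves the integral over a period:
    by Tonelli the left side is the average over z of integrals of translates of
    G, which all have the same value. *)
Lemma ge0_integral_periodic_smoothing (q : R -> R) (G : R -> \bar R) (delta : R) :
  measurable_fun setT q -> (forall z, 0 <= q z) -> (\int[mu]_z (q z)%:E = 1)%E ->
  measurable_fun setT G -> (forall x, 0 <= G x)%E ->
  (forall (x : R) (n : int), G (x + n%:~R) = G x) ->
  (\int[mu]_(x in unitI) \int[mu]_z ((q z)%:E * G (x - delta * z)%R) =
   \int[mu]_(x in unitI) G x)%E.
Proof.
move=> mq q0 q1 mG G0 GD.
pose F (u : measurableTypeR R * measurableTypeR R) : \bar R :=
  ((\1_(@unitI R) u.1)%:E * ((q u.2)%:E * G (u.1 - delta * u.2)%R))%E.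
have F0 u : (0 <= F u)%E by rewrite /F !mule_ge0 ?lee_fin.
have mF : measurable_fun setT F.
  apply: emeasurable_funM.
    apply/measurable_EFinP; apply: measurableT_comp => //.
    apply: measurable_indic; exact: measurable_unitI.
  exact: measurable_smoothing_kernel.
transitivity (\int[mu]_x \int[mu]_z F (x, z))%E.
  rewrite integral_mkcond; apply: eq_integral => x _.
  rewrite patchE /F/= indicE; case: ifPn => _.
    by apply: eq_integral => z _; rewrite mul1e.
  by under eq_integral do rewrite mul0e; rewrite integral0.
rewrite (fubini_tonelli F)//.
transitivity (\int[mu]_z ((q z)%:E * \int[mu]_(x in unitI) G x))%E.
  apply: eq_integral => z _.
  rewrite -(@ge0_integral_periodic_shift G (delta * z))//.
  rewrite -ge0_integralZl//; last 3 first.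
  - exact: measurable_unitI.
  - apply: measurable_funTS; apply: measurableT_comp => //.
    exact: measurable_funB.
  - by rewrite lee_fin.
  rewrite [RHS]integral_mkcond; apply: eq_integral => x _.
  by rewrite patchE /F/= indicE; case: ifPn => _; rewrite ?mul1e ?mul0e.
rewrite ge0_integralZr ?q1 ?mul1e//.
- exact/measurable_EFinP.
- by move=> z _; rewrite lee_fin.
- exact: integral_ge0.
Qed.

End Periodic.

(** * Folding an integral over the line onto one period *)

Section Folding.
Context {R : realType}.
Local Notation mu := (@lebesgue_measure R).

Lemma integrable_affine (a c : R) (f : R -> \bar R) : a != 0 ->
  mu.-integrable setT f -> mu.-integrable setT (fun x => f (affine a c x)).
Proof.
move=> a0 /integrableP[mf foo]; apply/integrableP; split.
  by apply: measurableT_comp => //; exact: measurable_affine.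
move: foo; rewrite (@ge0_integral_affine R a c)//; last first.
  by apply: measurableT_comp.
rewrite preimage_setT; set X := integral _ _ _.
case: X => [r _| |//]; first exact: ltry.
by rewrite gt0_muley// lte_fin normr_gt0.
Qed.

Lemma Rintegral_shift_itv (c x y : R) (f : R -> R) :
  mu.-integrable setT (EFin \o f) ->
  \int[mu]_(t in `[x, y[) f t = \int[mu]_(t in `[x - c, y - c[) f (t + c).
Proof.
move=> intf; have mf : measurable_fun setT f by case/integrableP: intf => /measurable_EFinP.
rewrite (@Rintegral_affine R 1 c)//; last exact: integrableS intf.
rewrite normr1 mul1r preimage_shift_itv; apply: eq_Rintegral => t _.
by rewrite /affine mul1r.
Qed.

(** Cut [-1,2) into three unit intervals and translate each to [0,1). *)
Lemma Rintegral_fold (F : R -> R) : mu.-integrable setT (EFin \o F) ->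
  (forall y, ~~ (-1 <= y < 2) -> F y = 0) ->
  \int[mu]_y F y = \int[mu]_(y in `[0, 1[) (F (y - 1) + F y + F (y + 1)).
Proof.
move=> intF F0.
have intS (D : set R) : measurable D -> mu.-integrable D (EFin \o F).
  by move=> mD; exact: integrableS intF.
have intD (c : R) : mu.-integrable `[0, 1[ (EFin \o (fun y => F (y + c))).
  apply: (@integrableS _ _ _ _ setT) => //.
  have := @integrable_affine 1 c _ (oner_neq0 _) intF.
  by congr integrable; apply/funext => y; rewrite /affine/= mul1r.
rewrite !RintegralD//; last 2 first.
- exact: intS.
- by apply: (integrableD _ (intD (-1)) (intS _ _)).
have -> : \int[mu]_(y in `[0, 1[) F (y - 1) = \int[mu]_(y in `[-1, 0[) F y.
  by rewrite [RHS](@Rintegral_shift_itv (-1))// !opprK addNr add0r.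
have -> : \int[mu]_(y in `[0, 1[) F (y + 1) = \int[mu]_(y in `[1, 2[) F y.
  rewrite [RHS](@Rintegral_shift_itv 1 1)// subrr.
  by rewrite (_ : 2 - 1 = 1)//; lra.
have cat (x y z : R) : x <= y -> y <= z ->
    \int[mu]_(t in `[x, y[) F t + \int[mu]_(t in `[y, z[) F t =
    \int[mu]_(t in `[x, z[) F t.
  move=> xy yz; rewrite -Rintegral_setU//.
  - by congr Rintegral; rewrite predeqE => t /=; rewrite !in_itv/=; lra.
  - by apply: intS; apply: measurableU.
  - by apply/disj_setPS => t /=; rewrite !in_itv/=; lra.
rewrite !cat; [|lra..].
rewrite [RHS]Rintegral_mkcond; apply: eq_Rintegral => y _.
rewrite patchE; case: ifPn => // yN; apply: F0.
by move: yN; rewrite notin_setE/= in_itv/= => /negP.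
Qed.

Lemma esum_int3 (f : int -> \bar R) : (forall n, 0 <= f n)%E ->
  (forall n : int, n \notin [:: -1; 0; 1] -> f n = 0%E) ->
  (\esum_(n in [set: int]) f n = f (-1)%R + f 0%R + f 1%R)%E.
Proof.
move=> f0 fN; rewrite (@esumID _ _ [set` [:: -1; 0; 1 : int]])// !setTI.
rewrite [X in (_ + X)%E]esum1 ?adde0; last first.
  by move=> n /= /negP; exact: fN.
rewrite esum_fset//; last exact: finite_seq.
by rewrite -fsbig_seq// !big_cons big_nil/= addr0 addrA.
Qed.

End Folding.

(** * The noise operator as a convolution with the periodic extension *)

Section Smoothing.
Context {R : realType}.
Local Notation mu := (@lebesgue_measure R).
Context (q : R -> R) (q_ge0 : forall z, 0 <= q z) (mq : measurable_fun setT q)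
  (q_mass : (\int[mu]_z (q z)%:E = 1)%E)
  (q_supp : forall z, 1 < `|z| -> q z = 0).
Context (delta : R) (delta_itv : 0 < delta < 1 / 4).
Context (h : R -> R) (mh : measurable_fun unitI h) (M : R)
  (hM : forall y, unitI y -> `|h y| <= M).

Let delta_gt0 : 0 < delta. Proof. by case/andP: delta_itv. Qed.

Let delta_lt_quarter : delta < 1 / 4. Proof. by case/andP: delta_itv. Qed.

Let ph := periodize h.

Let mph : measurable_fun setT ph.
Proof. exact: measurable_periodize. Qed.

Let phM y : `|ph y| <= M.
Proof. by apply: hM; rewrite /unitI/= in_itv/=; have := frac_itv y; lra. Qed.

Lemma integrable_profile : mu.-integrable setT (EFin \o q).
Proof.
apply/integrableP; split; first exact/measurable_EFinP.
by under eq_integral do rewrite /= ger0_norm//; rewrite q_mass ltry.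
Qed.

Lemma integrable_smoothing x :
  mu.-integrable setT (EFin \o (fun z => q z * ph (x - delta * z))).
Proof.
apply: le_integrable (integrableZl _ M integrable_profile) => //.
  apply/measurable_EFinP; apply: measurable_funM => //.
  apply: (measurableT_comp mph); apply: measurable_funB => //.
move=> z _ /=; rewrite lee_fin !normrM mulrC ler_pM//.
by apply: le_trans (phM _) (ler_norm _).
Qed.

(** For x, y in [0,1] and |n| >= 2 the argument is at least 1/delta > 4 in
    absolute value, outside the support of q. *)
Lemma qper_unitI x y : unitI x -> unitI y ->
  qper q delta x y = delta^-1 * q ((x - y - 1) / delta) +
    delta^-1 * q ((x - y) / delta) + delta^-1 * q ((x - y + 1) / delta).
Proof.
rewrite /unitI/= !in_itv/= => x01 y01; rewrite /qper esum_int3/= ?addr0//.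
- by move=> n; rewrite lee_fin mulr_ge0// invr_ge0 ltW.
- move=> n nN; congr EFin; rewrite q_supp ?mulr0//.
  have n2 : n%:~R <= -2 :> R \/ 2 <= n%:~R :> R.
    case: n nN => [[|[|n]]|[|n]]// _; [right|left].
      by rewrite -[2]/(2%:~R) ler_int.
    by rewrite -[-2]/((-2)%:~R) ler_int.
  rewrite normrM normfV (gtr0_norm delta_gt0).
  rewrite ltr_pdivlMr// mul1r.
  by rewrite ltr_normr; case: n2 => ?; apply/orP; [right|left]; move: delta_lt_quarter; lra.
Qed.

(** The substitution z = (x - y) / delta turns the convolution into an integral
    against q((x - y) / delta) / delta; this kernel vanishes unless -1 <= y < 2,
    and folding [-1,2) onto [0,1) sums it over three integer shifts, which is the
    periodized kernel. *)
Lemma noise_op_smoothing x : unitI x ->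
  noise_op q delta h x = \int[mu]_z (q z * ph (x - delta * z)).
Proof.
move=> Ix; move: (Ix); rewrite /unitI/= in_itv/= => x01.
have dN0 : delta != 0 by rewrite gt_eqF.
pose f z := q z * ph (x - delta * z).
have intf : mu.-integrable setT (EFin \o f) by exact: integrable_smoothing.
have mf : measurable_fun setT f by case/integrableP: intf => /measurable_EFinP.
pose a := - delta^-1.
have aN0 : a != 0 by rewrite oppr_eq0 invr_eq0.
pose F y := delta^-1 * f (affine a (x / delta) y).
have FE y : F y = delta^-1 * q ((x - y) / delta) * ph y.
  rewrite /F /f -mulrA; congr (_ * (q _ * ph _)); rewrite /affine /a; first lra.
  by rewrite mulrDr mulNr mulrN mulrA mulfV// mul1r mulrCA mulfV// mulr1; lra.
have intF : mu.-integrable setT (EFin \o F).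
  exact: (integrableZl _ delta^-1 (integrable_affine a (x / delta) _ aN0 intf)).
have -> : \int[mu]_z f z = \int[mu]_y F y.
  rewrite (@Rintegral_affine R a (x / delta))// preimage_setT.
  rewrite RintegralZl//; last exact: (integrable_affine a (x / delta) _ aN0 intf).
  by rewrite normrN gtr0_norm// invr_gt0.
rewrite Rintegral_fold//; last first.
  move=> y yN; rewrite FE q_supp ?mulr0 ?mul0r//.
  rewrite normrM normfV (gtr0_norm delta_gt0) ltr_pdivlMr// mul1r ltr_normr.
  move: yN; rewrite negb_and -ltNge -leNgt => /orP[y1|y2];
    apply/orP; [left|right]; move: delta_lt_quarter; lra.
have K y : 0 <= y < 1 -> F (y - 1) + F y + F (y + 1) = qper q delta x y * h y.
  move=> y01; rewrite !FE qper_unitI//; last by rewrite /unitI/= in_itv/=; lra.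
  have -> : ph (y - 1) = ph y by exact: (periodizeD h y (-1)).
  have -> : ph (y + 1) = ph y by exact: (periodizeD h y 1).
  rewrite (_ : ph y = h y); last exact: periodize_id.
  rewrite -!mulrDl addrAC addrC addrA; congr (_ * _).
  rewrite (_ : x - (y - 1) = x - y + 1); last lra.
  rewrite (_ : x - (y + 1) = x - y - 1); last lra.
  lra.
rewrite (@eq_Rintegral _ _ _ mu _ (fun y => qper q delta x y * h y)); last first.
  by move=> y; rewrite inE/= in_itv/= => /K.
rewrite Rintegral_itv_bndo_bndc//.
apply: (@eq_integrable _ _ _ mu _ _ (fun y => (F (y - 1) + F y + F (y + 1))%:E)) => //.
  by move=> y; rewrite inE/= in_itv/= => /K ->.
have intD (c : R) : mu.-integrable setT (EFin \o (fun y => F (y + c))).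
  have := @integrable_affine R 1 c _ (oner_neq0 _) intF.
  by congr integrable; apply/funext => y; rewrite /affine/= mul1r.
apply: (@integrableS _ _ _ _ setT) => //.
exact: (integrableD _ (integrableD _ (intD (-1)) intF) (intD 1)).
Qed.

(** Adding the bound M makes the integrand nonnegative, so that Tonelli's theorem
    provides measurability; q has mass 1, so this only adds M to the result. *)
Lemma measurable_noise_op : measurable_fun unitI (noise_op q delta h).
Proof.
pose G (t : R) : \bar R := (ph t + M)%:E.
have G0 t : (0 <= G t)%E.
  by rewrite lee_fin; have := phM t; rewrite ler_norml; lra.
have mG : measurable_fun setT G.
  by apply/measurable_EFinP; exact: measurable_funD.
have mS := measurable_smoothing _ _ delta mq q_ge0 mG G0.
apply: (eq_measurable_fun (fun x : R =>
    fine (\int[mu]_z ((q z)%:E * G (x - delta * z)%R))%E - M)).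
  move=> x; rewrite inE => Ix; rewrite noise_op_smoothing//.
  under eq_integral do rewrite -EFinM.
  rewrite -[fine _]/(\int[mu]_z (q z * (ph (x - delta * z) + M))).
  under eq_Rintegral do rewrite mulrDr.
  rewrite RintegralD//; last 2 first.
  - exact: integrable_smoothing.
  - have := integrableZl measurableT M integrable_profile.
    by congr integrable; apply/funext => z; rewrite /= mulrC EFinM.
  rewrite RintegralZr//; last exact: integrable_profile.
  by rewrite {2}/Rintegral q_mass mul1r addrK.
apply: measurable_funB => //; apply: measurable_funTS.
exact: measurableT_comp mS.
Qed.

Lemma osc_noise_op_le r x : 0 < r -> unitI x ->
  (osc (noise_op q delta h) r x <=
   \int[mu]_z ((q z)%:E * osc_on setT ph r (x - delta * z)%R))%E.
Proof.
move=> r0 Ix; apply: osc_on_le => y1 y2 Iy1 Iy2 hy1 hy2.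
rewrite !noise_op_smoothing// -RintegralB//; [|exact: integrable_smoothing..].
have intB := integrableB _ (integrable_smoothing y1) (integrable_smoothing y2).
rewrite EFin_normr_Rintegral//; last exact: intB.
apply: le_trans (le_abse_integral _ _ _) _ => //.
  by case/integrableP: (intB measurableT).
apply: ge0_le_integral => //.
- apply: measurableT_comp => //; by case/integrableP: (intB measurableT).
- apply: emeasurable_funM; first exact/measurable_EFinP.
  apply: (measurableT_comp (measurable_osc_on _ _ _)); exact: measurable_funB.
- move=> z _; rewrite /= -mulrBr normrM ger0_norm// EFinM.
  apply: lee_wpmul2l; first by rewrite lee_fin.
  by apply: osc_on_ub => //; lra.
Qed.

(** The pointwise bound is integrated over I, where averaging against q has no
    effect because the oscillation of the periodic extension is periodic. *)
Lemma osc1_noise_op_le r V : 0 < r ->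
  (forall y1 y2, unitI y1 -> unitI y2 -> `|h y1 - h y2| <= V) ->
  (osc1 (noise_op q delta h) r <= osc1 h r + (2 * r * V)%:E)%E.
Proof.
move=> r0 hV; apply: le_trans (integral_osc_periodize _ _ _ r0 hV).
rewrite -(@ge0_integral_periodic_smoothing R q _ delta)//; last 3 first.
- exact: measurable_osc_on.
- by move=> x; exact: osc_on_ge0.
- by move=> x n; exact: osc_on_periodizeD.
apply: ge0_le_integral => //.
- exact: measurable_unitI.
- by move=> x Ix; exact: osc_on_ge0.
- by apply: measurable_funTS; exact: measurable_osc_on.
- apply: measurable_funTS; apply: measurable_smoothing => //.
    exact: measurable_osc_on.
  by move=> x; exact: osc_on_ge0.
- by move=> x Ix; exact: osc_noise_op_le.
Qed.

Lemma norm1_noise_op_le : (norm1 (noise_op q delta h) <= norm1 h)%E.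
Proof.
have mG : measurable_fun setT (fun t => `|ph t|%:E).
  by apply/measurable_EFinP; exact: measurableT_comp.
have -> : norm1 h = (\int[mu]_(x in unitI) `|ph x|%:E)%E.
  rewrite /norm1 -!integral_itv_bndo_bndc; last 2 first.
  - exact: measurable_funTS.
  - apply/measurable_EFinP; apply: measurableT_comp => //.
    apply: measurable_funS mh; first exact: measurable_unitI.
    by move=> x /=; rewrite /unitI/= !in_itv/=; lra.
  by apply: eq_integral => x; rewrite inE/= in_itv/= => x01; rewrite /ph periodize_id.
rewrite -(@ge0_integral_periodic_smoothing R q _ delta)//; last first.
  by move=> x n; rewrite /ph periodizeD.
apply: ge0_le_integral => //.
- exact: measurable_unitI.
- apply/measurable_EFinP; apply: measurableT_comp => //; exact: measurable_noise_op.
- apply: measurable_funTS.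
  exact: (measurable_smoothing _ (fun t => `|ph t|%:E) delta mq q_ge0 mG).
- move=> x Ix; rewrite noise_op_smoothing// EFin_normr_Rintegral//;
    last exact: integrable_smoothing.
  apply: le_trans (le_abse_integral _ _ _) _ => //.
    by case/integrableP: (integrable_smoothing x).
  rewrite le_eqVlt; apply/orP; left; apply/eqP; apply: eq_integral => z _ /=.
  by rewrite normrM ger0_norm// EFinM.
Qed.

End Smoothing.

(** * Variation and norm under the noise operator *)

Section Variation.
Context {R : realType}.
Local Notation mu := (@lebesgue_measure R).

Lemma noise_profile_measurable (q : R -> R) :
  noise_profile q -> measurable_fun setT q.
Proof.
case=> -[dq _] _ _ _ _; apply: continuous_measurable_fun => x.
by apply: differentiable_continuous; exact/derivable1_diffP.
Qed.

Lemma noise_profile_supp (q : R -> R) (z : R) :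
  noise_profile q -> 1 < `|z| -> q z = 0.
Proof.
case=> _ _ supp _ _ z1; apply/eqP/negPn/negP => qz.
have /supp : closure [set z | q z != 0] z by exact: subset_closure.
by rewrite /= in_itv/= -ler_norml leNgt z1.
Qed.

Lemma fvar_ub (p : R) (h : R -> R) (r : R) : 0 < r <= 1 ->
  ((r `^ (- p^-1))%:E * osc1 h r <= fvar p h)%E.
Proof.
by move=> r01; apply: ereal_sup_ubound; exists r => //=; rewrite in_itv/=.
Qed.

Lemma osc1_ge0 (h : R -> R) (r : R) : 0 < r -> (0 <= osc1 h r)%E.
Proof. by move=> r0; apply: integral_ge0 => x Ix; exact: osc_on_ge0. Qed.

Lemma osc1_1_le_fvar (p : R) (h : R -> R) : (osc1 h 1 <= fvar p h)%E.
Proof.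
have := @fvar_ub p h 1; rewrite ltr01 lexx powR1 mul1e; exact.
Qed.

Lemma fvar_ge0 (p : R) (h : R -> R) : (0 <= fvar p h)%E.
Proof. by apply: le_trans (osc1_1_le_fvar p h); exact: osc1_ge0. Qed.

Lemma var_ge0 (p : R) (h : R -> R) : (0 <= var p h)%E.
Proof. by apply: le_ereal_inf_tmp => _ [g _ <-]; exact: fvar_ge0. Qed.

Lemma norm1_ge0 (h : R -> R) : (0 <= norm1 h)%E.
Proof. by apply: integral_ge0 => x _; rewrite lee_fin. Qed.

Lemma fvar_bounded (p V : R) (h : R -> R) : (fvar p h <= V%:E)%E ->
  forall y1 y2, unitI y1 -> unitI y2 -> `|h y1 - h y2| <= V.
Proof.
move=> hV y1 y2 I1 I2; rewrite -lee_fin; apply: le_trans (osc_total_le h _ _ I1 I2) _.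
exact: le_trans (osc1_1_le_fvar p h) hV.
Qed.

Lemma fvar_pointwise_bound (p V : R) (h : R -> R) : (fvar p h <= V%:E)%E ->
  forall y, unitI y -> `|h y| <= `|h 0| + V.
Proof.
move=> hV y Iy; have I0 : unitI (0 : R) by rewrite /unitI/= in_itv/=; lra.
have := fvar_bounded _ _ _ hV _ _ Iy I0.
by have := ler_normD (h y - h 0) (h 0); rewrite subrK; lra.
Qed.

(** With V = fvar p h, the bound Osc_1(h, r) + 2 r V on Osc_1(Q h, r) is
    multiplied by r^(-1/p): the first term becomes at most V, the second at most
    2 V because r^(1 - 1/p) <= 1. *)
Lemma fvar_noise_op_le (p : R) (q : R -> R) (delta : R) (h : R -> R) :
  1 <= p -> noise_profile q -> 0 < delta < 1 / 4 -> measurable_fun unitI h ->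
  (fvar p (noise_op q delta h) <= 3%:E * fvar p h)%E.
Proof.
move=> p1 hq hd mh; have mq := noise_profile_measurable _ hq.
have qsupp z := noise_profile_supp _ z hq.
have [_ q0 _ q1 _] := hq.
have [->|hoo] := eqVneq (fvar p h) +oo%E; first by rewrite gt0_muley ?leey.
have : fvar p h \is a fin_num by rewrite ge0_fin_numE ?fvar_ge0// lt_neqAle hoo leey.
move=> /fineK/esym; set V := fine _ => hV.
have V0 : 0 <= V by rewrite -lee_fin -hV fvar_ge0.
have hVle : (fvar p h <= V%:E)%E by rewrite hV.
apply: ge_ereal_sup => _ [r /= + <-]; rewrite in_itv/= => r01.
have r0 : 0 < r by lra.
have := osc1_noise_op_le q q0 mq q1 qsupp delta hd h mh _
  (fvar_pointwise_bound _ _ _ hVle) r V r0 (fvar_bounded _ _ _ hVle).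
move=> /(lee_wpmul2l (_ : 0 <= (r `^ (- p^-1))%:E)%E) => /(_ _)/le_trans.
apply; first by rewrite lee_fin powR_ge0.
rewrite ge0_muleDr ?osc1_ge0// ?lee_fin ?mulr_ge0//; last lra.
have -> : (3%:E * fvar p h = fvar p h + (2 * V)%:E)%E.
  by rewrite hV -EFinM -EFinD; congr EFin; lra.
apply: leeD; first exact: fvar_ub.
rewrite -EFinM lee_fin mulrA; apply: ler_wpM2r => //.
rewrite mulrCA -[leRHS]mulr1 ler_wpM2l//.
rewrite -[X in _ * X]powRr1 ?(ltW r0)// -powRD; last by rewrite (gt_eqF r0) implybT.
rewrite -[leRHS](powRr0 r); apply: ger_powR; first lra.
have := invf_le1 (lt_le_trans ltr01 p1); rewrite p1; lra.
Qed.

(** The functions over which var takes the infimum of fvar. *)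
Definition version_of (g h : R -> R) :=
  measurable_fun unitI h /\ {ae mu, forall x, unitI x -> h x = g x}.

Lemma noise_op_version (q : R -> R) (delta : R) (g h : R -> R) (x : R) :
  noise_profile q -> 0 < delta < 1 / 4 -> measurable_fun unitI g ->
  version_of g h -> unitI x -> noise_op q delta h x = noise_op q delta g x.
Proof.
move=> hq hd mg [mh hg] Ix; have mq := noise_profile_measurable _ hq.
have qsupp z := noise_profile_supp _ z hq.
have [_ q0 _ q1 _] := hq.
have mk (c : R) : measurable_fun unitI (fun y : R => delta^-1 * q ((x - y + c) / delta)).
  apply: measurable_funM => //; apply: (measurableT_comp mq).
  by apply: measurable_funM => //; apply: measurable_funD => //; apply: measurable_funB.
have mK : measurable_fun unitI (qper q delta x).
  apply: (eq_measurable_fun (fun y : R => delta^-1 * q ((x - y - 1) / delta) +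
    delta^-1 * q ((x - y + 0) / delta) + delta^-1 * q ((x - y + 1) / delta))).
    by move=> y; rewrite inE => Iy; rewrite addr0 qper_unitI.
  by apply: measurable_funD => //; apply: measurable_funD.
rewrite /noise_op /Rintegral; congr fine; apply: ae_eq_integral.
- exact: measurable_unitI.
- by apply/measurable_EFinP; exact: measurable_funM.
- by apply/measurable_EFinP; exact: measurable_funM.
- by apply: (@filterS _ _ (ae_filter_ringOfSetsType mu)) hg => y /[swap] Iy /(_ Iy) /= ->.
Qed.

Lemma norm1_version (g h : R -> R) : measurable_fun unitI g ->
  version_of g h -> norm1 h = norm1 g.
Proof.
move=> mg [mh hg]; apply: ae_eq_integral.
- exact: measurable_unitI.
- by apply/measurable_EFinP; exact: measurableT_comp.
- by apply/measurable_EFinP; exact: measurableT_comp.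
- by apply: (@filterS _ _ (ae_filter_ringOfSetsType mu)) hg => y /[swap] Iy /(_ Iy) /= ->.
Qed.

(** The noise operator does not distinguish versions, so the bound for each
    version h of g bounds var of the image of g; then take the infimum over h. *)
Lemma var_noise_op_le (p : R) (q : R -> R) (delta : R) (g : R -> R) :
  1 <= p -> noise_profile q -> 0 < delta < 1 / 4 -> measurable_fun unitI g ->
  (var p (noise_op q delta g) <= 3%:E * var p g)%E.
Proof.
move=> p1 hq hd mg; rewrite -lee_pdivrMl//; apply: le_ereal_inf_tmp => _ [h hg <-].
rewrite lee_pdivrMl//.
have [->|hoo] := eqVneq (fvar p h) +oo%E; first by rewrite gt0_muley ?leey.
have [mh _] := hg.
apply: le_trans (fvar_noise_op_le p q delta h p1 hq hd mh).
have hfin : fvar p h \is a fin_num by rewrite ge0_fin_numE ?fvar_ge0// lt_neqAle hoo leey.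
have hVle : (fvar p h <= (fine (fvar p h))%:E)%E by rewrite fineK.
have [_ q0 _ q1 _] := hq.
apply: ereal_inf_lbound; exists (noise_op q delta h) => //; split.
  exact: (measurable_noise_op _ q0 (noise_profile_measurable _ hq) q1
    (fun z => noise_profile_supp _ z hq) _ hd _ mh _ (fvar_pointwise_bound _ _ _ hVle)).
by apply: aeW => x Ix; exact: noise_op_version.
Qed.

(** Finite variation is used only to replace g by a bounded version. *)
Lemma norm1_noise_op_le_of_var (p : R) (q : R -> R) (delta : R) (g : R -> R) :
  noise_profile q -> 0 < delta < 1 / 4 -> measurable_fun unitI g ->
  (var p g < +oo)%E -> (norm1 (noise_op q delta g) <= norm1 g)%E.
Proof.
move=> hq hd mg /ereal_inf_lt[_ [h hg <-] hoo]; have [mh _] := hg.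
have hfin : fvar p h \is a fin_num by rewrite ge0_fin_numE ?fvar_ge0.
have hVle : (fvar p h <= (fine (fvar p h))%:E)%E by rewrite fineK.
have [_ q0 _ q1 _] := hq.
rewrite -(norm1_version g h)//.
have := norm1_noise_op_le q q0 (noise_profile_measurable _ hq) q1
    (fun z => noise_profile_supp _ z hq) _ hd _ mh _ (fvar_pointwise_bound _ _ _ hVle).
apply: le_trans; rewrite le_eqVlt; apply/orP; left; apply/eqP.
by apply: eq_integral => x; rewrite inE => Ix; rewrite (noise_op_version q delta g h).
Qed.

End Variation.

(** * The Frobenius--Perron operator and the conclusion *)

Section TransferOperator.
Context {R : realType}.
Local Notation mu := (@lebesgue_measure R).

(** The integral of a nonnegative function is a supremum over the simple functions
    below it, and those below f on D are below g on E.  This form of monotonicity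
    applies when D is a preimage under a map whose measurability is unknown. *)
Lemma le_integral_subset_nonmeasurable (D E : set R) (f g : R -> \bar R) :
  D `<=` E -> (forall x, 0 <= f x)%E -> (forall x, 0 <= g x)%E ->
  (forall x, D x -> f x <= g x)%E ->
  (\int[mu]_(x in D) f x <= \int[mu]_(x in E) g x)%E.
Proof.
move=> DE f0 g0 fg; rewrite [leLHS]integral_mkcond [leRHS]integral_mkcond.
have p0 (A : set R) (k : R -> \bar R) :
    (forall x, 0 <= k x)%E -> forall x, (0 <= (k \_ A) x)%E.
  by move=> k0 x; rewrite patchE; case: ifPn.
rewrite !ge0_integralTE; [|exact: p0|exact: p0].
apply: le_ereal_sup => _ [k /= kf <-]; exists k => //= x.
apply: le_trans (kf x) _; rewrite !patchE; case: ifPn => [/set_mem Dx|_].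
  by rewrite mem_set; [exact: fg|exact: DE].
by case: ifPn.
Qed.

Lemma abse_integral_subset_le (D E : set R) (f : R -> R) : D `<=` E ->
  (`|\int[mu]_(x in D) (f x)%:E| <= \int[mu]_(x in E) `|f x|%:E)%E.
Proof.
move=> DE; rewrite integralE.
set X := (\int[mu]_(x in D) _)%E; set Y := (\int[mu]_(x in D) _)%E; set N := (X in (_ <= X)%E).
have N0 : (0 <= N)%E by apply: integral_ge0.
have X0 : (0 <= X)%E by apply: integral_ge0 => x _; exact: funepos_ge0.
have Y0 : (0 <= Y)%E by apply: integral_ge0 => x _; exact: funeneg_ge0.
have XN : (X <= N)%E.
  apply: le_integral_subset_nonmeasurable => // x _.
  by rewrite funeposE/= ge_max !lee_fin ler_norm normr_ge0.
have YN : (Y <= N)%E.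
  apply: le_integral_subset_nonmeasurable => // x _.
  by rewrite funenegE/= ge_max !lee_fin -normrN ler_norm normr_ge0.
have [XY|XY] := leP 0%E (X - Y)%E.
  by rewrite gee0_abs// -[leRHS]sube0; exact: leeB.
have [->|Noo] := eqVneq N +oo%E; first exact: leey.
have Yfin : Y \is a fin_num.
  by rewrite ge0_fin_numE// (le_lt_trans YN)// lt_neqAle Noo leey.
rewrite lte0_abs// oppeB ?fin_num_adde_defl ?fin_numN// addeC -[leRHS]sube0.
exact: leeB.
Qed.

(** Split I according to the sign of P f.  On each part the integral of |P f| is
    the absolute value of an integral of f over a subset of I; the factor 2 comes
    from bounding the two parts separately. *)
Lemma norm1_frobenius_perron_le (tau : R -> R) (P : (R -> R) -> R -> R) (f : R -> R) :
  frobenius_perron tau P -> mu.-integrable unitI (EFin \o f) ->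
  (norm1 (P f) <= 2%:E * norm1 f)%E.
Proof.
move=> hP intf; have [intP PE] := hP f intf.
have mP : measurable_fun unitI (P f) by case/integrableP: intP => /measurable_EFinP.
have mI := @measurable_unitI R.
pose Ap := unitI `&` P f @^-1` `[0, +oo[; pose An := unitI `&` P f @^-1` `]-oo, 0[.
have mAp : measurable Ap by exact: mP.
have mAn : measurable An by exact: mP.
have IE : @unitI R = Ap `|` An.
  apply/seteqP; split => [x Ix|x [[]|[]]//].
  by have [x0|x0] := leP 0 (P f x); [left|right]; split => //=; rewrite in_itv/= ?andbT.
have sgn (A : set R) : measurable A -> A `<=` unitI ->
    (`|\int[mu]_(x in A) (P f x)%:E| <= norm1 f)%E.
  move=> mA AI; rewrite PE//; apply: abse_integral_subset_le.
  by move=> x [].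
rewrite {1}/norm1 IE ge0_integral_setU//=; last 2 first.
- apply/measurable_EFinP; apply: measurableT_comp => //; by rewrite -IE.
- apply/disj_setPS => x [[_ /=]]; rewrite in_itv/= andbT => x0 [_ /=].
  by rewrite in_itv/= ltNge x0.
have -> : (2%:E * norm1 f = norm1 f + norm1 f)%E.
  by rewrite (_ : 2 = 1 + 1)// EFinD ge0_muleDl ?mul1e.
apply: leeD.
- apply: le_trans (sgn _ mAp _); last by move=> x [].
  rewrite (eq_integral (fun x : measurableTypeR R => (P f x)%:E)) ?lee_abs//.
  by move=> x; rewrite inE => -[_ /=]; rewrite in_itv/= andbT => x0; rewrite ger0_norm.
- apply: le_trans (sgn _ mAn _); last by move=> x [].
  rewrite (eq_integral (fun x : measurableTypeR R => - (P f x)%:E)%E).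
    rewrite integralN; last first.
      by apply: integrable_add_def => //; apply: integrableS intP => // x [Ix _].
    by rewrite -abseN lee_abs.
  by move=> x; rewrite inE => -[_ /=]; rewrite in_itv/= => x0; rewrite ltr0_norm.
Qed.

Lemma C1tilde_ge3 (p : R) (q : R -> R) : 1 <= p -> 3 <= C1tilde p q.
Proof.
move=> p1; have ip0 : 0 <= p^-1 by rewrite invr_ge0; lra.
have two : 2 <= 2 `^ (1 + p^-1) :> R.
  by rewrite -[leLHS]powRr1//; apply: ler_powR; lra.
have one : 1 <= 2 `^ p^-1 :> R.
  by rewrite -[leLHS](powRr0 2); apply: ler_powR; lra.
have m1 : 1 <= Num.max 1 (4 * fine ('N[mu]_+oo[EFin \o derive1 q])%E).
  by rewrite le_max lexx.
have AB : 3 <= (1 + 2 `^ (1 + p^-1)) * 2 `^ p^-1 :> R.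
  by apply: le_trans (_ : 3 <= 1 + 2 `^ (1 + p^-1)) (ler_peMr _ one); lra.
by apply: le_trans AB (ler_peMr (le_trans _ AB) m1).
Qed.

End TransferOperator.

Theorem theorem3p6 (R : realType) (p s eps alpha0 C0 : R)
    (tau q : R -> R) (Ptau : (R -> R) -> R -> R)
    (hp : 1 <= p) (hs : 1 < s) (heps : 0 < eps)
    (htau : piecewise_expanding s eps tau)
    (hq : noise_profile q)
    (hP : frobenius_perron tau Ptau)
    (hLY : lasota_yorke p s Ptau alpha0 C0)
    (hjoint : alpha0 < 1 / C1tilde p q) :
  exists alpha C : R,
    [/\ 0 < alpha < 1, 0 < C
      & forall delta : R, 0 < delta < 1 / 4 -> forall f : R -> R, BV p f ->
        (normBV p (noise_op q delta (Ptau f)) <=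
           alpha%:E * normBV p f + C%:E * norm1 f)%E].
Proof.
have [a01 C0_gt0 _ LY] := hLY.
exists (3 * alpha0), (3 * C0 + 2); split.
- have C3 := C1tilde_ge3 _ q hp.
  have := ler_wpM2l (ltW (proj1 (andP a01))) C3.
  by move: hjoint; rewrite ltr_pdivlMr; lra.
- lra.
move=> delta hd f Bf; have [intf varf] := Bf.
have [/integrableP[/measurable_EFinP mPf _] _] := hP f intf.
have norm1f : (norm1 f < +oo)%E by case/integrableP: intf.
have Bnf : (normBV p f < +oo)%E by exact: lte_add_pinfty.
have B0 : (0 <= normBV p f)%E by rewrite adde_ge0 ?var_ge0 ?norm1_ge0.
have varP : (var p (Ptau f) < +oo)%E.
  apply: le_lt_trans (LY f Bf) _.
  by apply: lte_add_pinfty; apply: lte_mul_pinfty => //; rewrite lee_fin; lra.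
apply: (@le_trans _ _ (3%:E * var p (Ptau f) + norm1 (Ptau f))%E).
  apply: leeD; first exact: var_noise_op_le.
  exact: norm1_noise_op_le_of_var varP.
apply: (@le_trans _ _ (3%:E * (alpha0%:E * normBV p f + C0%:E * norm1 f) + 2%:E * norm1 f)%E).
  apply: leeD; last exact: norm1_frobenius_perron_le hP intf.
  by apply: lee_wpmul2l; [rewrite lee_fin|exact: LY].
rewrite ge0_muleDr ?mule_ge0 ?lee_fin ?norm1_ge0//; [|lra..].
rewrite !muleA -!EFinM -addeA -ge0_muleDl ?lee_fin//; last lra.
Qed.
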